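(* Let $r$ and $s$ be positive integers with $r \geq s \geq 3$, $r \leq 2s - 2$ and $\gcd(r,s) > 1$. If $r \geq s + \frac{s}{\gcd(r,s)} - 1$, then $f(s,r,2) = f(s,r,\mathbb{Z}) = 4s + r - 3$.
   Context: For integers $a\le b$, $[a,b]=\{n\in\mathbb{N} : a\le n\le b\}$. For a finite set $X\subseteq\mathbb{N}$, $\mathrm{diam}(X)=\max(X)-\min(X)$. $f(s,r,2)$ is the smallest positive integer $n$ such that for every coloring $\Delta:[1,n]\to\{1,2\}$ there exist $S_1,S_2\subseteq[1,n]$ with: (a) $S_1$, $S_2$ each monochromatic (not necessarily the same color); (b) $|S_1|=s$, $|S_2|=r$; (c) $\max(S_1)<\min(S_2)$; (d) $\mathrm{diam}(S_1)\le\mathrm{diam}(S_2)$. Given $\Delta:[1,n]\to\mathbb{Z}$, a subset $Y$ is zero-sum mod $m$ if $\sum_{y\in Y}\Delta(y)\equiv 0\pmod m$. $f(s,r,\mathbb{Z})$ is the smallest positive integer $n$ such that for every coloring $\Delta:[1,n]\to\mathbb{Z}$ there exist $S_1,S_2\subseteq[1,n]$ satisfying (b), (c), (d) and (a') $S_1$ is zero-sum mod $s$ and $S_2$ is zero-sum mod $r$. *)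

(* Defs.v *)
From mathcomp Require Import all_boot all_order all_algebra.
From mathcomp Require Import finmap.
From mathcomp Require Import boolp.

Set Implicit Arguments.
Unset Strict Implicit.
Unset Printing Implicit Defensive.

Import GRing.Theory.

Local Open Scope nat_scope.
Local Open Scope fset_scope.

Definition interval (a b : nat) : {fset nat} :=
  [fset i in iota a (b.+1 - a)].

Definition fmax (X : {fset nat}) : nat := \max_(x <- X) x.

(* The neutral element [fmax X] makes this the minimum of a nonempty X;
   [fmin fset0 = fmax fset0 = 0]. *)
Definition fmin (X : {fset nat}) : nat := \big[minn/fmax X]_(x <- X) x.

Definition diam (X : {fset nat}) : nat := fmax X - fmin X.

Definition monochromatic (C : Type) (Delta : nat -> C) (X : {fset nat}) : Prop :=
  forall x y, x \in X -> y \in X -> Delta x = Delta y.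

Definition zero_sum (m : nat) (Delta : nat -> int) (Y : {fset nat}) : Prop :=
  (\sum_(y <- Y) Delta y = 0 %[mod m%:Z])%Z%R.

Definition admissible (s r n : nat) (S1 S2 : {fset nat}) : Prop :=
  [/\ S1 `<=` interval 1 n /\ S2 `<=` interval 1 n,
      #|` S1| = s /\ #|` S2| = r,
      fmax S1 < fmin S2 &
      diam S1 <= diam S2].

(* A coloring of [1, n] is given as a function on nat; as S1 and S2 are subsets
   of [1, n], its values elsewhere are irrelevant. *)
Definition forces_mono2 (s r n : nat) : Prop :=
  forall Delta : nat -> 'I_2, exists S1 S2 : {fset nat},
    [/\ admissible s r n S1 S2, monochromatic Delta S1 & monochromatic Delta S2].

Definition forces_zero_sum (s r n : nat) : Prop :=
  forall Delta : nat -> int, exists S1 S2 : {fset nat},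
    [/\ admissible s r n S1 S2, zero_sum s Delta S1 & zero_sum r Delta S2].

(* The smallest positive integer satisfying P; the value 0 is taken exactly
   when there is none. *)
Definition least_pos (P : nat -> Prop) : nat :=
  match pselect (exists n, (0 < n) && `[< P n >]) with
  | left exP => ex_minn exP
  | right _ => 0
  end.

Lemma least_posP (P : nat -> Prop) (n : nat) : 0 < n ->
  (least_pos P = n) <-> (P n /\ forall m, 0 < m -> P m -> n <= m).
Proof.
move=> n0; rewrite /least_pos; case: pselect => [exP|nexP]; last first.
  split=> [eq0|[Pn _]]; first by rewrite -eq0 in n0.
  by case: nexP; exists n; rewrite n0; apply/asboolP.
case: ex_minnP => k /andP[k0 /asboolP Pk] kmin; split=> [<-|[Pn nmin]].
  by split=> // m m0 Pm; apply: kmin; rewrite m0; apply/asboolP.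
apply/eqP; rewrite eqn_leq nmin // andbT.
by apply: kmin; rewrite n0; apply/asboolP.
Qed.

Definition f2 (s r : nat) : nat := least_pos (forces_mono2 s r).

Definition fZ (s r : nat) : nat := least_pos (forces_zero_sum s r).

(* Main.v *)
From mathcomp Require Import all_boot all_order all_algebra zify finmap.
Require Import Defs.

(* The Erdos-Ginzburg-Ziv theorem (EGZ) gives S1 inside [1, 2s-1], so one may
   assume that no zero-sum r-set of the remaining 2s+r-2 integers has diameter at
   least 2s-2.  Let F and G be the first and the last r of these integers.  A
   zero-sum r-set meeting both F and G minus its first element has diameter at
   least 2s-2, so F is the only zero-sum r-set in the union of these 2r-1
   integers; an inverse form of EGZ then makes Delta constant mod r on F.
   Likewise EGZ forces G to be zero-sum mod r.  With d = gcd(r,s), Delta is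
   constant mod d on F, so r >= s + s/d - 1 yields a zero-sum s-set inside F as a
   union of d sets of size s/d that are zero-sum mod s/d after dividing by d.  It
   precedes G and has diameter at most r - 1 = diam G.

   The lower bound comes from the blocks 1^(s-1) 2^(s-1) 1^(2s-1) 2^(r-1). *)

Set Implicit Arguments.
Unset Strict Implicit.
Unset Printing Implicit Defensive.

Import GRing.Theory.
Local Open Scope nat_scope.

(** The ground type is arbitrary so that EGZ can be applied to families of sets as well as to
    integers. *)
Definition zero_sum_set (T : finType) (D : T -> int) (m : nat) (B : {set T}) : bool :=
  (#|B| == m) && (m%:Z %| (\sum_(i in B) D i)%R)%Z.

(** * Sums of selections from pairs in a prime field *)

Section Pairs.
Variable T : eqType.

Definition unpair (ps : seq (T * T)) : seq T :=
  flatten [seq [:: x.1; x.2] | x <- ps].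

Definition selects (c : seq T) (ps : seq (T * T)) : bool :=
  all2 (fun y x => (y == x.1) || (y == x.2)) c ps.

Lemma size_unpair ps : size (unpair ps) = (size ps).*2.
Proof. by elim: ps => //= x ps IH; rewrite /unpair /= -/(unpair ps) IH doubleS. Qed.

Lemma selects_size c ps : selects c ps -> size c = size ps.
Proof. by elim: c ps => [|y c IH] [|x ps] //= /andP[_ /IH ->]. Qed.

Lemma selects_sub c ps : selects c ps -> {subset c <= unpair ps}.
Proof.
elim: c ps => [|y c IH] [|x ps] //= /andP[yx /IH cps] z.
rewrite /unpair /= !inE => /orP[/eqP->|/cps ->]; last by rewrite !orbT.
by rewrite orbA yx.
Qed.

Lemma selects_uniq c ps : selects c ps -> uniq (unpair ps) -> uniq c.
Proof.
elim: c ps => [|y c IH] [|x ps] //= /andP[yx cps].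
rewrite /unpair /= -/(unpair ps) inE negb_or -!andbA => /and4P[_ x1 x2 ups].
rewrite (IH ps) // andbT; apply/negP => /(selects_sub cps) ys.
by move: yx ys x1 x2 => /orP[]/eqP-> ->.
Qed.

Lemma perm_unpair ps ps' : perm_eq ps ps' -> perm_eq (unpair ps) (unpair ps').
Proof. by move=> h; rewrite perm_flatten // perm_map. Qed.

Lemma perm_unpair_zip s t : size s = size t -> perm_eq (unpair (zip s t)) (s ++ t).
Proof.
elim: s t => [|x s IH] [|y t] //= [/IH h]; rewrite /unpair /= -/(unpair _).
by rewrite perm_cons perm_sym -(cat1s y t) perm_catCA /= perm_cons perm_sym.
Qed.

Lemma count_unpair (a : pred T) ps :
  all (fun x => a x.1 || a x.2) ps -> size ps <= count a (unpair ps).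
Proof.
elim: ps => //= x ps IH /andP[ax /IH h]; rewrite /unpair /= -/(unpair ps).
by case: (a x.1) (a x.2) ax h => [] [] //=; lia.
Qed.

Variables (q : nat) (phi : T -> 'F_q).
Hypothesis q_pr : prime q.
Local Open Scope ring_scope.

Definition reach (ps : seq (T * T)) : {set 'F_q} :=
  foldr (fun x (A : {set 'F_q}) => [set phi x.1 + a | a in A] :|: [set phi x.2 + a | a in A])
    [set 0] ps.

Lemma reachP ps t : t \in reach ps ->
  exists2 c, selects c ps & \sum_(y <- c) phi y = t.
Proof.
elim: ps t => [|x ps IH] t /=.
  by rewrite inE => /eqP->; exists [::]; rewrite ?big_nil.
rewrite inE => /orP[]/imsetP[a /IH[c cps <-] ->].
  by exists (x.1 :: c); rewrite ?big_cons //= eqxx.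
by exists (x.2 :: c); rewrite ?big_cons //= eqxx orbT.
Qed.

(** A nonzero [d] generates the additive group of ['F_q]: from [x], every [y] is reached in (y - x)
    / d steps. *)
Lemma shift_stable_full (A : {set 'F_q}) (d x : 'F_q) :
  d != 0 -> x \in A -> (forall y, y \in A -> y + d \in A) -> A = setT.
Proof.
move=> d0 xA st; apply/setP => y; rewrite inE.
have h k : x + d *+ k \in A.
  by elim: k => [|k IH]; rewrite ?mulr0n ?addr0 // mulrSr addrA; apply: st.
suff -> : y = x + d *+ (((y - x) / d) : 'F_q) by apply: h.
by rewrite -mulr_natr natr_Zp mulrC divfK // addrC subrK.
Qed.

(** A Cauchy-Davenport bound. A further pair enlarges the set of sums unless the two translates
    coincide; in that case the set is stable under a nonzero shift, hence already everything. *)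
Lemma card_reach ps : all (fun x => phi x.1 != phi x.2) ps ->
  (minn q (size ps).+1 <= #|reach ps|)%N.
Proof.
elim: ps => [_|x ps IH] /=; first by rewrite cards1 geq_minr.
case/andP=> x12 /IH {IH}; set A := reach ps => IH.
set A1 := imset _ _; set A2 := imset _ _.
have cA1 : #|A1| = #|A| by rewrite card_imset //; apply: addrI.
have cA2 : #|A2| = #|A| by rewrite card_imset //; apply: addrI.
have le12 : (#|A| <= #|A1 :|: A2|)%N by rewrite -cA1 subset_leq_card // subsetUl.
have [lt|ge] := ltnP #|A| #|A1 :|: A2|.
  apply: leq_trans lt; rewrite geq_min ltnS; move: IH; rewrite geq_min.
  by case/orP=> h; rewrite ?ltnS ?h ?orbT // (leq_trans h).
have e : A1 = A2.
  have /eqP e1 : A1 == A1 :|: A2 by rewrite eqEcard subsetUl cA1.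
  have /eqP e2 : A2 == A1 :|: A2 by rewrite eqEcard subsetUr cA2.
  by rewrite e1 -e2.
have q0 : (0 < q)%N by apply: prime_gt0.
have /card_gt0P[a aA] : (0 < #|A|)%N by apply: leq_trans IH; lia.
have AT : A = setT.
  apply: (@shift_stable_full A (phi x.1 - phi x.2) a) => //.
    by rewrite subr_eq0.
  move=> y yA; have : phi x.1 + y \in A2 by rewrite -e imset_f.
  by case/imsetP=> z zA ez; rewrite addrA (addrC y) ez addrC addKr.
apply: leq_trans le12; rewrite AT cardsT card_Fp //; exact: geq_minl.
Qed.

Lemma exists_selection ps t : all (fun x => phi x.1 != phi x.2) ps ->
  size ps = q.-1 -> exists2 c, selects c ps & \sum_(y <- c) phi y = t.
Proof.
move=> h sz; apply: reachP; suff -> : reach ps = setT by rewrite inE.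
apply/eqP; rewrite eqEcard subsetT cardsT card_Fp //.
apply: leq_trans (card_reach h); rewrite sz prednK ?prime_gt0 //.
by rewrite minnn.
Qed.
End Pairs.

(** * EGZ and its inverse form for a prime modulus *)

Section Prime.
Variables (T : finType) (D : T -> int) (q : nat).
Hypothesis q_pr : prime q.
Let phi (x : T) : 'F_q := (D x)%:~R%R.

Lemma residue_eq x y : (phi x == phi y) = (q%:Z %| (D x - D y)%R)%Z.
Proof.
by rewrite (dvdz_pcharf (pchar_Fp q_pr)) rmorphB subr_eq0.
Qed.

Lemma zero_sum_set_uniq (s : seq T) : uniq s -> size s = q ->
  zero_sum_set D q [set x in s] = (\sum_(x <- s) phi x == 0)%R.
Proof.
move=> us sz; rewrite /zero_sum_set cardsE (card_uniqP us) sz eqxx /=.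
rewrite (dvdz_pcharf (pchar_Fp q_pr)) rmorph_sum /=.
by rewrite (big_uniq _ us) /=; under eq_bigl do rewrite inE.
Qed.

Lemma constant_zero_sum (A : {set T}) (v : 'F_q) :
  q <= #|[set x in A | phi x == v]| ->
  exists B : {set T},
    [/\ B \subset A, zero_sum_set D q B & {in B, forall x, phi x = v}].
Proof.
case/card_geqP=> s [us sz sA]; exists [set x in s].
have sv x : x \in s -> x \in A /\ phi x = v.
  by move/sA; rewrite inE => /andP[? /eqP].
split=> [||x]; last by rewrite inE => /sv[].
  by apply/subsetP => x; rewrite inE => /sv[].
rewrite zero_sum_set_uniq // big_seq (eq_bigr (fun=> v)); last first.
  by move=> x /sv[].
rewrite -big_seq big_const_seq count_predT sz iter_addr_0.
by rewrite -mulr_natr pchar_Fp_0 // mulr0.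
Qed.

Definition pairing (A : {set T}) (u : T) (ps : seq (T * T)) : Prop :=
  [/\ perm_eq (u :: unpair ps) (enum A), size ps = q.-1 &
      all (fun x => phi x.1 != phi x.2) ps].

Lemma pairing_swap A u a b ps : pairing A u ((a, b) :: ps) ->
  phi u != phi b -> pairing A a ((u, b) :: ps).
Proof.
case=> pe sz /=/andP[ab dis] ub; split=> //=; last by rewrite ub.
apply: perm_trans pe; rewrite /unpair /= -/(unpair ps).
by rewrite -[a :: _]/([:: a] ++ [:: u] ++ _) perm_catCA.
Qed.

Lemma pairing_flip A u a b ps : pairing A u ((a, b) :: ps) ->
  pairing A u ((b, a) :: ps).
Proof.
case=> pe sz /=/andP[ab dis]; split=> //=; last by rewrite eq_sym ab.
apply: perm_trans pe; rewrite /unpair /= -/(unpair ps) perm_cons.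
by rewrite -[b :: _]/([:: b] ++ [:: a] ++ _) perm_catCA.
Qed.

Lemma pairing_perm A u ps ps' : perm_eq ps ps' ->
  pairing A u ps -> pairing A u ps'.
Proof.
move=> pp [pe sz dis]; split.
- by apply: perm_trans pe; rewrite perm_cons perm_unpair // perm_sym.
- by rewrite -(perm_size pp).
- by rewrite -(perm_all _ pp).
Qed.

(** Selections from q - 1 pairs attain every residue, in particular [- phi u]; adding [u] gives q
    elements of sum zero. The last clause holds because a selection takes one member of each pair.
    The first pair suffices there, since [pairing_perm] brings any pair to the front. *)
Lemma pairing_zero_sum A u ps : pairing A u ps ->
  exists B : {set T}, [/\ B \subset A, zero_sum_set D q B, u \in B &
    forall a b ps', ps = (a, b) :: ps' -> ~~ ((a \in B) && (b \in B))].
Proof.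
case=> pe sz dis.
have [c cps sc] := exists_selection q_pr (- phi u)%R dis sz.
have := perm_uniq pe; rewrite enum_uniq /= => /andP[uN ups].
have uc : uniq (u :: c).
  by rewrite /= (selects_uniq cps ups) andbT; apply: contra uN => /(selects_sub cps).
have szc : size (u :: c) = q.
  by rewrite /= (selects_size cps) sz prednK // prime_gt0.
exists [set x in u :: c]; split.
- apply/subsetP => x; rewrite inE -[x \in A]mem_enum -(perm_mem pe) !inE.
  by case/orP=> [->|/(selects_sub cps)->] //; rewrite orbT.
- by rewrite zero_sum_set_uniq // big_cons sc subrr.
- by rewrite !inE eqxx.
move=> a b ps' eps; move: cps uN ups; rewrite {}eps {sc uc szc}.
case: c => //= y c /andP[yab cps].
rewrite /unpair /= -/(unpair ps') !inE !negb_or.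
case/and3P=> ua ub _ /andP[/andP[ab aN] /andP[bN _]].
rewrite ![_ == u]eq_sym (negbTE ua) (negbTE ub) /=.
have aNc : a \in c = false.
  by apply: contraNF aN => /(selects_sub cps).
have bNc : b \in c = false.
  by apply: contraNF bN => /(selects_sub cps).
rewrite aNc bNc !orbF; apply: contra ab => /andP[/eqP-> /eqP->] //.
Qed.

(** Sort [A] by residue and, with k = q - 1, compare the entries at i and k + i. If they agree for
    some i < k, the q entries from i to k + i share one residue; otherwise these are the pairs, and
    the last entry is the singleton. *)
Lemma pairing_or_constant (A : {set T}) : #|A| = 2 * q - 1 ->
  (exists v : 'F_q, q <= #|[set x in A | phi x == v]|) \/
  (exists u ps, pairing A u ps).
Proof.
move=> cA; pose e := [rel x y : T | (phi x <= phi y)%N].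
have q0 := prime_gt0 q_pr.
have e_tr : transitive e by move=> y x z; apply: leq_trans.
have e_refl : reflexive e by move=> x /=.
have e_tot : total e by move=> x y; apply: leq_total.
pose l := sort e (enum A).
have pl : perm_eq l (enum A) by rewrite perm_sort.
have sl : sorted e l by apply: sort_sorted.
have ul : uniq l by rewrite (perm_uniq pl) enum_uniq.
have sz : size l = 2 * q - 1 by rewrite (perm_size pl) -cardE.
have [x0 _] : exists x, x \in A by apply/card_gt0P; lia.
have [k eq_k] : exists k, q = k.+1 by exists q.-1; rewrite prednK.
have [/existsP[[i ik] /= ei]|/existsPn ne] :=
  boolP [exists i : 'I_k, phi (nth x0 l i) == phi (nth x0 l (k + i))].
  left; exists (phi (nth x0 l i)); apply/card_geqP.
  have szt : size (take q (drop i l)) = q.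
    by rewrite size_takel // size_drop sz; lia.
  exists (take q (drop i l)); split=> //.
    by rewrite take_uniq // drop_uniq.
  move=> y /(nthP x0)[j]; rewrite szt => jq <-;
  rewrite nth_take // nth_drop inE -mem_enum -(perm_mem pl).
  rewrite mem_nth; last by rewrite sz; lia.
  have h1 : e (nth x0 l i) (nth x0 l (i + j)).
    by apply: (sorted_leq_nth e_tr e_refl x0 sl); rewrite ?inE; lia.
  have h2 : e (nth x0 l (i + j)) (nth x0 l (k + i)).
    by apply: (sorted_leq_nth e_tr e_refl x0 sl); rewrite ?inE; lia.
  by apply/eqP/val_inj/anti_leq/andP; split; [rewrite (eqP ei); apply: h2|apply: h1].
right; exists (nth x0 l (k + k)), (zip (take k l) (take k (drop k l))).
have sz1 : size (take k l) = k by rewrite size_takel //; lia.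
have sz2 : size (take k (drop k l)) = k by rewrite size_takel // size_drop sz; lia.
split; last 2 first.
- by rewrite size_zip sz1 sz2 minnn eq_k.
- apply/(all_nthP (x0, x0)) => i; rewrite size_zip sz1 sz2 minnn => ik.
  by rewrite nth_zip ?sz1 //= !nth_take // nth_drop (ne (Ordinal ik)).
apply: perm_trans pl; rewrite perm_sym.
rewrite -{1}(cat_take_drop k l) -{1}(cat_take_drop k (drop k l)) catA perm_sym.
have -> : drop k (drop k l) = [:: nth x0 l (k + k)].
  rewrite drop_drop (drop_nth x0); last by lia.
  by rewrite drop_oversize //; lia.
rewrite cats1 perm_sym perm_rcons perm_cons perm_sym perm_unpair_zip //.
by rewrite sz1 sz2.
Qed.

Lemma egz_prime (A : {set T}) : #|A| = 2 * q - 1 ->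
  exists2 B : {set T}, B \subset A & zero_sum_set D q B.
Proof.
case/pairing_or_constant => [[v /constant_zero_sum[B [? ? _]]]|]; first by exists B.
by case=> u [ps /pairing_zero_sum[B [? ? _ _]]]; exists B.
Qed.

(* The singleton of a pairing always belongs to [F], so it cannot be exchanged
   with both members of a pair: each pair contains an element of its colour. *)
Lemma egz_unique_prime (A F : {set T}) : #|A| = 2 * q - 1 ->
  (forall B : {set T}, B \subset A -> zero_sum_set D q B -> B = F) ->
  {in F &, forall x y, (q%:Z %| (D x - D y)%R)%Z}.
Proof.
move=> cA uF.
suff [v /constant_zero_sum[B [BA Bz Bv]]] :
    exists v : 'F_q, q <= #|[set x in A | phi x == v]|.
  rewrite -(uF B BA Bz) => x y xB yB.
  by rewrite -residue_eq (Bv x) ?(Bv y).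
case: (pairing_or_constant cA) => // [[u [ps pA]]]; exists (phi u).
have inF u' ps' : pairing A u' ps' -> u' \in F.
  by case/pairing_zero_sum=> B [BA Bz uB _]; rewrite -(uF B BA Bz).
have col x : x \in ps -> (phi x.1 == phi u) || (phi x.2 == phi u).
  case: x => a b xps; move: pA => /(pairing_perm (perm_to_rem xps)) pA.
  have [B [BA Bz _ /(_ _ _ _ erefl)]] := pairing_zero_sum pA.
  rewrite (uF B BA Bz); apply: contraR; rewrite negb_or ![_ == phi u]eq_sym.
  case/andP=> ua ub; rewrite (inF _ _ (pairing_swap pA ub)).
  by rewrite (inF _ _ (pairing_swap (pairing_flip pA) ua)).
case: pA => pe sz _.
have -> : #|[set x in A | phi x == phi u]| = count (fun x => phi x == phi u) (enum A).
  rewrite -sum1_card -sum1_count big_enum_cond /=.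
  by apply: eq_bigl => x; rewrite inE.
rewrite -(permP pe) /= eqxx (leq_trans (leqSpred q)) // -sz.
by rewrite add1n ltnS count_unpair //; apply/allP.
Qed.
End Prime.

(** * Disjoint blocks and EGZ for every modulus *)

Section Blocks.
Variables (T : finType) (D : T -> int).
Implicit Types (A B C F : {set T}) (P J : {set {set T}}).

Lemma exists_subset_card A k : k <= #|A| -> exists2 B : {set T}, B \subset A & #|B| = k.
Proof.
case/card_geqP=> s [us sz sA]; exists [set x in s].
  by apply/subsetP => x; rewrite inE => /sA.
by rewrite cardsE (card_uniqP us).
Qed.

Definition blocks (p : nat) A P : Prop :=
  [/\ trivIset P, cover P \subset A & {in P, forall B, zero_sum_set D p B}].

(** The division is exact on blocks. It makes the blocks the elements of a new zero-sum problem
    modulo [q], whose solutions unite to zero-sum sets modulo [p * q] by [sum_blocks]. *)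
Definition block_quotient (p : nat) B : int := ((\sum_(i in B) D i)%R %/ p)%Z.

Lemma blocks_add p A P C : 0 < p -> C \subset A -> zero_sum_set D p C ->
  blocks p (A :\: C) P -> blocks p A (C |: P) /\ #|C |: P| = #|P|.+1.
Proof.
move=> p0 CA Cz [tP cP Pz].
have dC : {in P, forall B, [disjoint C & B]}.
  move=> B BP; rewrite disjoint_sym.
  have BA : B \subset A :\: C by apply: subset_trans cP; apply: bigcup_sup.
  by move: BA; rewrite subsetD => /andP[].
(* Since [0 < p], no block is empty; this is what makes [C], disjoint from every member of [P], a
   new member. *)
have P0 : set0 \notin P.
  by apply/negP => /Pz /andP[]; rewrite cards0 eq_sym -leqn0 leqNgt p0.
have [tCP CP] := trivIsetU1 dC tP P0.
split; last by rewrite cardsU1 CP.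
split=> //.
  rewrite /cover bigcup_setU big_set1 subUset CA.
  exact: subset_trans cP (subsetDl _ _).
by move=> B; rewrite !inE => /orP[/eqP->|/Pz].
Qed.

Lemma sum_blocks p q A P J : blocks p A P -> J \subset P ->
  zero_sum_set (block_quotient p) q J ->
  cover J \subset A /\ zero_sum_set D (p * q) (cover J).
Proof.
move=> [tP cP Pz] JP /andP[/eqP cJ dJ].
have tJ := trivIsetS JP tP.
split.
  apply: subset_trans cP; apply/bigcupsP => B BJ.
  by apply: bigcup_sup; apply: (subsetP JP).
apply/andP; split.
  rewrite -(eqP tJ) (eq_bigr (fun=> p)) => [|B /(subsetP JP)/Pz/andP[/eqP]//].
  by rewrite sum_nat_const cJ mulnC.
rewrite big_trivIset //=.
rewrite (eq_bigr (fun B => p%:Z * block_quotient p B)%R) => [|B BJ]; last first.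
  by have /andP[_ h] := Pz _ (subsetP JP _ BJ); rewrite mulrC divzK.
by rewrite -mulr_sumr PoszM dvdz_mul.
Qed.

(** Greedy extraction: each block removes [p] elements, and the last one still finds 2p - 1. EGZ
    modulo [p] is a hypothesis because the lemma is used inside the induction that proves [egz]. *)
Lemma exists_blocks p k A :
  (forall C, 2 * p - 1 <= #|C| -> exists2 B : {set T}, B \subset C & zero_sum_set D p B) ->
  0 < p -> k.+1 * p - 1 <= #|A| -> exists2 P, blocks p A P & #|P| = k.
Proof.
move=> egz_p p0; elim: k A => [|k IH] A cA.
  exists set0; last by rewrite cards0.
  split=> [||B]; rewrite ?inE //.
    by apply/trivIsetP => B C; rewrite inE.
  by rewrite /cover big_set0 sub0set.
have [|C CA Cz] := egz_p A; first by nia.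
have [|P bP cP] := IH (A :\: C).
  by have /andP[/eqP cC _] := Cz; rewrite cardsDS // cC; nia.
have [bCP cCP] := blocks_add p0 CA Cz bP.
by exists (C |: P) => //; rewrite cCP cP.
Qed.
End Blocks.

(** Write m = pq with q prime. A set of 2m - 1 = 2q * p - 1 elements is just large enough for 2q - 1
    disjoint blocks of size p, and EGZ modulo q selects q of these blocks. *)
Theorem egz (m : nat) (T : finType) (D : T -> int) (A : {set T}) :
  0 < m -> 2 * m - 1 <= #|A| ->
  exists2 B : {set T}, B \subset A & zero_sum_set D m B.
Proof.
elim/ltn_ind: m T D A => m IH T D A m0 cA.
have [m1|m1] := leqP m 1.
  have -> : m = 1 by lia.
  have /card_gt0P[x xA] : 0 < #|A| by lia.
  by exists [set x]; rewrite ?sub1set // /zero_sum_set cards1 eqxx dvd1z.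
have q_pr := pdiv_prime m1; set q := pdiv m in q_pr.
have [q1 q0] := (prime_gt1 q_pr, prime_gt0 q_pr).
pose p := m %/ q.
have em : m = p * q by rewrite divnK // pdiv_dvd.
have p0 : 0 < p by rewrite lt0n; apply: contraTneq m0; rewrite em => ->.
have pm : p < m by rewrite em ltn_Pmulr.
have [||P bP cP] := @exists_blocks T D p (2 * q - 1) A _ p0.
- by move=> C; apply: IH.
- by move: cA; rewrite em; nia.
have [J JP Jz] := egz_prime (block_quotient D p) q_pr cP.
have [? ?] := sum_blocks bP JP Jz.
by exists (cover J); rewrite ?em.
Qed.

(** * The inverse form of EGZ for an arbitrary modulus *)

Section Unique.
Variables (T : finType) (D : T -> int) (A F : {set T}) (p q : nat).
Hypotheses (q_pr : prime q) (p0 : 0 < p).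
Hypotheses (cA : #|A| = 2 * (p * q) - 1) (FA : F \subset A) (cF : #|F| = p * q).
Hypothesis uF : forall B : {set T},
  B \subset A -> zero_sum_set D (p * q) B -> B = F.
Implicit Types (B C Y Z : {set T}) (P : {set {set T}}).

Let q1 : 1 < q := prime_gt1 q_pr.
Let sigma B : int := (\sum_(i in B) D i)%R.

Let zero_sum_gt0 B : zero_sum_set D p B -> exists x, x \in B.
Proof. by case/andP=> /eqP cB _; apply/card_gt0P; rewrite cB. Qed.

Let block_meet P B C x : blocks D p A P -> B \in P -> C \in P ->
  x \in B -> x \in C -> B = C.
Proof.
case=> /trivIsetP tP _ _ BP CP xB xC; apply/eqP; apply: contraTT xB.
by move/(tP _ _ BP CP)/disjointFl => ->.
Qed.

(** A family of q blocks whose quotients are zero-sum modulo [q] has union [F], so it consists of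
    exactly the blocks inside [F]. The quotients thus satisfy the uniqueness hypothesis of
    [egz_unique_prime] and are congruent modulo [q] on [J]. *)
Lemma blocks_unique P : blocks D p A P -> #|P| = 2 * q - 1 ->
  let J := [set B in P | B \subset F] in
  cover J = F /\ {in J &, forall B C, ((p * q)%N %| (sigma B - sigma C)%R)%Z}.
Proof.
move=> bP cP J; have [tP cvP Pz] := bP.
have eqJ (J' : {set {set T}}) : J' \subset P -> zero_sum_set (block_quotient D p) q J' ->
    cover J' = F /\ J' = J.
  move=> JP Jz; have [/uF h /h {}h] := sum_blocks bP JP Jz; split=> //.
  apply/setP => B; rewrite inE; apply/idP/andP => [BJ|[BP BF]].
    by rewrite (subsetP JP) // -h; split=> //; apply: bigcup_sup.
  have [x xB] := zero_sum_gt0 (Pz _ BP).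
  have := subsetP BF _ xB; rewrite -h => /bigcupP[C CJ xC].
  by rewrite (block_meet bP BP (subsetP JP _ CJ) xB xC).
have [J' J'P J'z] := egz_prime (block_quotient D p) q_pr cP.
have [cJ eJ] := eqJ _ J'P J'z; split; first by rewrite -eJ.
have uJ := egz_unique_prime q_pr cP (fun J'' h h' => (eqJ J'' h h').2).
move=> B C BJ CJ; have := uJ _ _ BJ CJ.
have pP X : X \in J -> (sigma X = p%:Z * block_quotient D p X)%R.
  by rewrite inE => /andP[/Pz/andP[_ h] _]; rewrite mulrC divzK.
by rewrite !pP // -mulrBr PoszM => h; apply: dvdz_mul.
Qed.

Lemma exists_p_blocks k C : k.+1 * p - 1 <= #|C| ->
  exists2 P, blocks D p C P & #|P| = k.
Proof. by apply: exists_blocks => // B cB; apply: egz. Qed.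

(* Since C extends to a family of 2q-1 blocks, F is a union of members of a family
   that contains C. *)
Lemma block_in_or_out C : C \subset A -> zero_sum_set D p C ->
  C \subset F \/ [disjoint C & F].
Proof.
move=> CA Cz; have cC : #|C| = p by case/andP: Cz => /eqP.
have [|P bP cP] := @exists_p_blocks (2 * q - 2) (A :\: C).
  by rewrite cardsDS // cA cC; move: p0 q1; clear; nia.
have [bCP cCP] := blocks_add p0 CA Cz bP.
have [|cov _] := blocks_unique bCP; first by rewrite cCP cP; move: q1; clear; lia.
have [d|] := boolP [disjoint C & F]; first by right.
rewrite -setI_eq0 => /set0Pn[x /setIP[xC xF]].
left; move: xF; rewrite -{1}cov => /bigcupP[B]; rewrite inE => /andP[BP BF] xB.
by rewrite (block_meet bCP _ BP xC xB) // setU11.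
Qed.

(* Adding p-1 elements outside F to Y leaves room for only one block, Y itself. *)
Lemma subset_zero_sum Y : Y \subset F -> #|Y| = p -> zero_sum_set D p Y.
Proof.
move=> YF cY.
have cAF : #|A :\: F| = p * q - 1 by rewrite cardsDS // cA cF; move: (p * q); clear; lia.
have [|L LAF cL] := @exists_subset_card _ (A :\: F) (p - 1); first by rewrite cAF leq_sub2r // leq_pmulr // ltnW.
have dL : [disjoint L & F] by move: LAF; rewrite subsetD => /andP[].
have LA : L \subset A by apply: subset_trans LAF (subsetDl _ _).
have dLY : [disjoint Y & L] by rewrite disjoint_sym (disjointWr YF).
have [|C CYL Cz] := @egz p T D (Y :|: L) p0.
  by rewrite cardsU disjoint_setI0 // cards0 cY cL; clear; lia.
have cC : #|C| = p by case/andP: Cz => /eqP.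
have CA : C \subset A.
  by apply: subset_trans CYL _; rewrite subUset LA (subset_trans YF).
have [CF|dC] := block_in_or_out CA Cz.
  suff /eqP-> : Y == C by [].
  rewrite eq_sym eqEcard cC cY leqnn andbT; apply/subsetP => x xC.
  have := subsetP CYL _ xC; rewrite inE => /orP[//|xL].
  by have := disjointFr dL xL; rewrite (subsetP CF).
have : C \subset L.
  apply/subsetP => x xC; have := subsetP CYL _ xC; rewrite inE => /orP[xY|//].
  by have := disjointFr dC xC; rewrite (subsetP YF).
by move/subset_leq_card; rewrite cC cL subn1 leqNgt ltn_predL p0.
Qed.

(** Both sets are blocks by [subset_zero_sum]. The remaining (2q - 2)p - 1 elements of [A] supply 2q
    - 3 further blocks, and [blocks_unique] compares the two that lie in [F]. *)
Lemma disjoint_sums_eq Y Z : Y \subset F -> Z \subset F -> [disjoint Y & Z] ->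
  #|Y| = p -> #|Z| = p -> ((p * q)%N %| (sigma Y - sigma Z)%R)%Z.
Proof.
move=> YF ZF dYZ cY cZ.
have [YA ZA] := (subset_trans YF FA, subset_trans ZF FA).
have ZAY : Z \subset A :\: Y by rewrite subsetD ZA disjoint_sym.
have [|P bP cP] := @exists_p_blocks (2 * q - 3) (A :\: Y :\: Z).
  by rewrite cardsDS // cardsDS // cA cY cZ; move: p0 q1; clear; nia.
have [bZP cZP] := blocks_add p0 ZAY (subset_zero_sum ZF cZ) bP.
have [bYP cYP] := blocks_add p0 YA (subset_zero_sum YF cY) bZP.
have [|_ h] := blocks_unique bYP; first by rewrite cYP cZP cP; move: q1; clear; lia.
by apply: h; rewrite !inE eqxx ?YF ?ZF ?orbT.
Qed.

Lemma swap_sums_eq b c Y : b \in F -> c \in F -> b != c ->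
  Y \subset F :\: [set b; c] -> #|Y| = p - 1 ->
  ((p * q)%N %| (sigma (b |: Y) - sigma (c |: Y))%R)%Z.
Proof.
move=> bF cF' bc YF cY.
have YF' : Y \subset F by apply: subset_trans YF (subsetDl _ _).
have dY : [disjoint Y & [set b; c]] by move: YF; rewrite subsetD => /andP[].
have [bY cY'] : b \notin Y /\ c \notin Y.
  by split; apply/negP => /(disjointFr dY); rewrite !inE eqxx ?orbT.
have card_b : #|b |: Y| = p by rewrite cardsU1 bY cY add1n subn1 prednK.
have card_c : #|c |: Y| = p by rewrite cardsU1 cY' cY add1n subn1 prednK.
have bYF : b |: Y \subset F by rewrite subUset sub1set bF.
have cYF : c |: Y \subset F by rewrite subUset sub1set cF'.
(* For q at least 3, [F] has room for a block [Z] disjoint from both sets, and each of their sums is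
   compared with that of [Z]. *)
have [q3|q2] := ltnP 2 q.
  have [|Z ZF cZ] := @exists_subset_card _ (F :\: [set b; c] :\: Y) p.
    have : p * 3 <= p * q by rewrite leq_mul2l q3 orbT.
    rewrite cardsDS // cardsDS ?subUset ?sub1set ?bF // cF cards2 bc cY /=.
    by move: (p * q) p0 => m; clear; lia.
  have [ZF' Zbc ZY] : [/\ Z \subset F, [disjoint Z & [set b; c]] & [disjoint Z & Y]].
    by move: ZF; rewrite !subsetD => /andP[/andP[]].
  have dZ x : x \in [set b; c] -> [disjoint x |: Y & Z].
    move=> xbc; rewrite disjoints_subset; apply/subsetP => y; rewrite !inE.
    case/orP=> [/eqP->|yY]; apply/negP => yZ.
      by rewrite (disjointFr Zbc yZ) in xbc.
    by rewrite (disjointFr ZY yZ) in yY.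
  have hb := disjoint_sums_eq bYF ZF' (dZ b (set21 _ _)) card_b cZ.
  have hc := disjoint_sums_eq cYF ZF' (dZ c (set22 _ _)) card_c cZ.
  have -> : (sigma (b |: Y) - sigma (c |: Y) =
     (sigma (b |: Y) - sigma Z) - (sigma (c |: Y) - sigma Z))%R.
    by rewrite opprB addrA subrK.
  by rewrite rpredB.
(* For q = 2, take a block [Z] outside [F] instead. If [X] is a p-subset of [F], the union of [X]
   and [Z] differs from [F], so its sum is a multiple of p but not of 2p. It is therefore an odd
   multiple of p, and two such sums differ by a multiple of 2p. *)
have eq2 : q = 2 by apply/eqP; rewrite eqn_leq q2.
have cAF : #|A :\: F| = p * q - 1 by rewrite cardsDS // cA cF; move: (p * q); clear; lia.
have [|Z ZAF Zz] := @egz p T D (A :\: F) p0; first by rewrite cAF eq2 mulnC.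
have [z zZ] := zero_sum_gt0 Zz.
have [ZA dZF] : Z \subset A /\ [disjoint Z & F].
  by move: ZAF; rewrite subsetD => /andP[].
have pZ : (p %| sigma Z)%Z by case/andP: Zz.
have notz (X : {set T}) : X \subset F -> #|X| = p ->
    exists k : int, (sigma X = p%:Z * (2 * k + 1) - sigma Z)%R.
  move=> XF cX.
  have /andP[_ pX] := subset_zero_sum XF cX.
  have dXZ : [disjoint X & Z] by rewrite disjoint_sym (disjointWr XF).
  have nz : ~~ ((p * q)%N %| (sigma X + sigma Z)%R)%Z.
    apply: contraL (isT) => h.
    have : X :|: Z = F.
      apply: uF; first by rewrite subUset ZA (subset_trans XF).
      apply/andP; split; last first.
        rewrite (eq_bigl [in [predU X & Z]]) => [|i]; last by rewrite !inE.
        by rewrite bigU.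
      rewrite cardsU disjoint_setI0 // cards0 cX.
      by case/andP: Zz => /eqP-> _; rewrite eq2; clear; lia.
    by move/setP/(_ z); rewrite inE zZ orbT (disjointFr dZF).
  have /dvdzP[k ek] : (p %| (sigma X + sigma Z)%R)%Z by rewrite rpredD.
  have nk : ~~ (2 %| k)%Z.
    apply: contra nz; rewrite ek eq2 PoszM mulrC => h.
    by apply: dvdz_mul.
  exists (k %/ 2)%Z; have -> : (2 * (k %/ 2)%Z + 1 = k)%R by move: nk; clear; lia.
  by rewrite mulrC -ek addrK.
have [k ->] := notz _ bYF card_b; have [l ->] := notz _ cYF card_c.
apply/dvdzP; exists (k - l)%R; rewrite eq2; move: (sigma Z) => t; clear; lia.
Qed.
End Unique.

(** Completing [b] and [c] by the same p - 1 elements of [F] gives two blocks with congruent sums by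
    [swap_sums_eq]; cancelling the common part leaves [D b - D c]. *)
Theorem egz_unique (n : nat) (T : finType) (D : T -> int) (A F : {set T}) :
  0 < n -> #|A| = 2 * n - 1 -> F \subset A -> #|F| = n ->
  (forall B : {set T}, B \subset A -> zero_sum_set D n B -> B = F) ->
  {in F &, forall x y, (n%:Z %| (D x - D y)%R)%Z}.
Proof.
move=> n0 cA FA cF uF b c bF cF'.
have [->|bc] := eqVneq b c; first by rewrite subrr dvdz0.
have [n1|n1] := leqP n 1.
  by have -> : n = 1 by [lia]; rewrite dvd1z.
have q_pr := pdiv_prime n1; set q := pdiv n in q_pr.
have [q1 q0] := (prime_gt1 q_pr, prime_gt0 q_pr).
pose p := n %/ q.
have en : n = p * q by rewrite divnK // pdiv_dvd.
have p0 : 0 < p by rewrite lt0n; apply: contraTneq n0; rewrite en => ->.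
move: cA cF uF; rewrite en => cA cF uF.
have [|Y YF cY] := @exists_subset_card _ (F :\: [set b; c]) (p - 1).
  have : p * 2 <= p * q by rewrite leq_mul2l q1 orbT.
  by rewrite cardsDS ?subUset ?sub1set ?bF // cF cards2 bc /=; move: (p * q) p0 => m; clear; lia.
have dY : [disjoint Y & [set b; c]] by move: YF; rewrite subsetD => /andP[].
have [bY cY'] : b \notin Y /\ c \notin Y.
  by split; apply/negP => /(disjointFr dY); rewrite !inE eqxx ?orbT.
have := swap_sums_eq q_pr p0 cA FA cF uF bF cF' bc YF cY.
by rewrite !big_setU1 //= opprD addrACA subrr addr0.
Qed.

(** Write D = c + d D' on [A]. Over dt elements the constant contributes a multiple of dt, so it
    suffices that t divides the sum of D'. A union of d disjoint t-sets that are zero-sum for D'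
    modulo t has this property. *)
Lemma egz_congruent (d t : nat) (c : int) (T : finType) (D : T -> int) (A : {set T}) :
  0 < d -> 0 < t -> d * t + t - 1 <= #|A| ->
  {in A, forall x, (d%:Z %| (D x - c)%R)%Z} ->
  exists2 B : {set T}, B \subset A & zero_sum_set D (d * t) B.
Proof.
move=> d0 t0 cA Dc; pose D' x : int := ((D x - c)%R %/ d)%Z.
have [|||P [tP cP Pz] szP] := @exists_blocks T D' t d A.
- by move=> C cC; apply: egz.
- by [].
- by apply: leq_trans cA; rewrite mulSn addnC.
have card_P : #|cover P| = d * t.
  rewrite -(eqP tP) (eq_bigr (fun=> t)) => [|B /Pz/andP[/eqP]//].
  by rewrite sum_nat_const szP.
exists (cover P) => //; rewrite /zero_sum_set card_P eqxx /=.
rewrite (eq_bigr (fun x => c + d%:Z * D' x)%R) => [|x /(subsetP cP)/Dc h].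
  rewrite big_split /= sumr_const card_P -mulr_sumr rpredD //.
    by rewrite -mulr_natr natz dvdz_mull.
  rewrite PoszM dvdz_mul // big_trivIset //= rpred_sum // => B /Pz.
  by case/andP.
by rewrite mulrC divzK // addrC subrK.
Qed.

Local Open Scope fset_scope.
Local Open Scope nat_scope.

(** * Passage from finite types to finite sets of integers *)

Section Transfer.
Variables (X : {fset nat}) (Delta : nat -> int).

Definition fset_of (B : {set X}) : {fset nat} := [fset val x | x in B].
Definition set_of (Y : {fset nat}) : {set X} := [set x | val x \in Y].

Lemma fset_of_sub B : fset_of B `<=` X.
Proof. by apply/fsubsetP => x /imfsetP[y _ ->]; apply: valP. Qed.

Lemma fset_ofK B : set_of (fset_of B) = B.
Proof.
apply/setP => x; rewrite inE; apply/imfsetP/idP => [[y yB /val_inj ->]//|xB].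
by exists x.
Qed.

Lemma set_ofK Y : Y `<=` X -> fset_of (set_of Y) = Y.
Proof.
move=> YX; apply/fsetP => x; apply/imfsetP/idP => [[y + ->]|xY].
  by rewrite !inE.
by exists [` fsubsetP YX _ xY]; rewrite ?inE.
Qed.

Lemma card_fset_of B : #|` fset_of B| = #|B|.
Proof. by rewrite card_imfset //= ?cardE //; apply: val_inj. Qed.

Lemma fset_of_zero_sum m B :
  zero_sum_set (fun x : X => Delta (val x)) m B <->
  (#|` fset_of B| = m /\ zero_sum m Delta (fset_of B)).
Proof.
rewrite /zero_sum_set /zero_sum card_fset_of.
have -> : (\sum_(y <- fset_of B) Delta y = \sum_(x in B) Delta (val x))%R.
  by rewrite big_imfset /= ?big_enum //; move=> x y _ _; apply: val_inj.
split=> [/andP[/eqP-> h]|[-> h]]; first by split=> //; apply/eqP; rewrite eqz_mod_dvd subr0.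
by rewrite eqxx /=; move/eqP: h; rewrite eqz_mod_dvd subr0.
Qed.
End Transfer.

Lemma egz_fset m (Delta : nat -> int) (X : {fset nat}) :
  0 < m -> 2 * m - 1 <= #|` X| ->
  exists B, [/\ B `<=` X, #|` B| = m & zero_sum m Delta B].
Proof.
move=> m0 cX; have [|B _ /fset_of_zero_sum[cB Bz]] :=
  @egz m X (fun x => Delta (val x)) setT m0; first by rewrite cardsT -cardfE.
by exists (fset_of B); rewrite fset_of_sub.
Qed.

Lemma egz_unique_fset n (Delta : nat -> int) (A F : {fset nat}) :
  0 < n -> #|` A| = 2 * n - 1 -> F `<=` A -> #|` F| = n ->
  (forall B, B `<=` A -> #|` B| = n -> zero_sum n Delta B -> B = F) ->
  {in F &, forall x y, (n%:Z %| (Delta x - Delta y)%R)%Z}.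
Proof.
move=> n0 cA FA cF uF x y xF yF.
pose x' : A := [` fsubsetP FA _ xF]; pose y' : A := [` fsubsetP FA _ yF].
apply: (@egz_unique n A (fun x => Delta (val x)) setT (set_of A F) _ _ _ _ _ x' y').
- by [].
- by rewrite cardsT -cardfE.
- exact: subsetT.
- by rewrite -card_fset_of set_ofK.
- move=> B _ /fset_of_zero_sum[cB Bz].
  by rewrite -(uF _ (fset_of_sub B) cB Bz) fset_ofK.
- by rewrite inE.
- by rewrite inE.
Qed.

Lemma egz_congruent_fset d t (c : int) (Delta : nat -> int) (X : {fset nat}) :
  0 < d -> 0 < t -> d * t + t - 1 <= #|` X| ->
  {in X, forall x, (d%:Z %| (Delta x - c)%R)%Z} ->
  exists B, [/\ B `<=` X, #|` B| = d * t & zero_sum (d * t) Delta B].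
Proof.
move=> d0 t0 cX h; have [||B _ /fset_of_zero_sum[cB Bz]] :=
  @egz_congruent d t c X (fun x => Delta (val x)) setT d0 t0.
- by rewrite cardsT -cardfE.
- by move=> x _; apply: h; apply: valP.
by exists (fset_of B); rewrite fset_of_sub.
Qed.

(** * Intervals, extrema and diameters *)

Lemma in_interval a b x : (x \in interval a b) = (a <= x <= b).
Proof. by rewrite /interval inE mem_iota; lia. Qed.

Lemma card_interval a b : #|` interval a b| = b.+1 - a.
Proof.
rewrite /interval card_fseq undup_id ?iota_uniq ?size_iota //.
Qed.

Lemma card_two_intervals (B : {fset nat}) a u v b :
  (forall x, x \in B -> (a <= x <= u) || (v <= x <= b)) ->
  #|` B| <= (u.+1 - a) + (b.+1 - v).
Proof.
move=> h; rewrite -(size_iota a (u.+1 - a)) -(size_iota v (b.+1 - v)) -size_cat.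
by apply: uniq_leq_size => // x /h; rewrite mem_cat !mem_iota; lia.
Qed.

Lemma card_one_interval (B : {fset nat}) a b :
  (forall x, x \in B -> a <= x <= b) -> #|` B| <= b.+1 - a.
Proof.
move=> h; rewrite -(size_iota a (b.+1 - a)).
by apply: uniq_leq_size => // x /h; rewrite mem_iota; lia.
Qed.

Section Extrema.
Variable X : {fset nat}.

Lemma le_fmax x : x \in X -> x <= fmax X.
Proof. by move=> xX; exact: (@leq_bigmax_seq _ (enum_fset X) xpredT (fun y => y) x xX isT). Qed.

Lemma fmax_le b : (forall x, x \in X -> x <= b) -> fmax X <= b.
Proof. by move=> h; apply/bigmax_leqP_seq => x xX _; apply: h. Qed.

Lemma fmin_le x : x \in X -> fmin X <= x.
Proof.
rewrite /fmin; move: (fmax X) => z; rewrite -[x \in X]/(x \in enum_fset X).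
elim: (enum_fset X) => // y s IH; rewrite inE big_cons geq_min.
by case/orP=> [/eqP->|/IH->]; rewrite ?leqnn ?orbT.
Qed.

Lemma fmin_ge a : 0 < #|` X| -> (forall x, x \in X -> a <= x) -> a <= fmin X.
Proof.
rewrite cardfs_gt0 => /fset0Pn[x xX] h; rewrite /fmin.
(* The iterated minimum starts from [fmax X], so the bound is needed for this default value too. *)
have : a <= fmax X by apply: leq_trans (le_fmax xX); apply: h.
move: (fmax X) => z az; rewrite big_seq_cond.
by apply: (big_ind (fun y => a <= y)) => // [y w|y /andP[/h]//]; rewrite leq_min => -> ->.
Qed.

Lemma fmax_in : 0 < #|` X| -> fmax X \in X.
Proof.
move=> X0; rewrite /fmax -big_filter filter_predT.
have : 0 < size (enum_fset X) by [].
rewrite -[_ \in X]/(_ \in enum_fset X); elim: (enum_fset X) => // y [|z s] IH _.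
  by rewrite big_cons big_nil maxn0 inE.
rewrite big_cons /maxn; case: ifP => _; last by rewrite inE eqxx.
by rewrite inE IH ?orbT.
Qed.

Lemma diam_le a b : 0 < #|` X| -> (forall x, x \in X -> a <= x <= b) ->
  diam X <= b - a.
Proof.
move=> X0 h; apply: leq_sub; first by apply: fmax_le => x /h/andP[].
by apply: fmin_ge => // x /h/andP[].
Qed.

(** When u < v, the v - u - 1 integers strictly between them are missing from [X] but lie between
    its extrema. *)
Lemma diam_split u v x y : x \in X -> x <= u -> y \in X -> v <= y ->
  (forall z, z \in X -> (z <= u) || (v <= z)) ->
  #|` X| + v <= diam X + u + 2.
Proof.
move=> xX xu yX vy h.
have : #|` X| <= (u.+1 - fmin X) + ((fmax X).+1 - v).
  by apply: card_two_intervals => z zX; move: (h z zX) (fmin_le zX) (le_fmax zX); lia.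
by move: (fmin_le xX) (le_fmax yX); rewrite /diam; lia.
Qed.
End Extrema.

(** * The lower bound *)

Definition extremal_coloring (s x : nat) : 'I_2 :=
  if (x < s) || (2 * s - 1 <= x <= 4 * s - 3) then ord0 else ord_max.

Lemma extremal_coloringE s x y :
  extremal_coloring s x = extremal_coloring s y ->
  ((x < s) || (2 * s - 1 <= x <= 4 * s - 3)) =
  ((y < s) || (2 * s - 1 <= y <= 4 * s - 3)).
Proof. by rewrite /extremal_coloring; do 2 case: ifP. Qed.

Lemma forces_mono2_lb s r n : 0 < s -> s <= r -> forces_mono2 s r n ->
  4 * s + r - 3 <= n.
Proof.
move=> s0 sr /(_ (extremal_coloring s))[S1 [S2 [[[sub1 sub2] [c1 c2] lt12 le12] m1 m2]]].
rewrite leqNgt; apply/negP => ltn.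
have in1 x : x \in S1 -> 1 <= x <= n by move/(fsubsetP sub1); rewrite in_interval.
have in2 x : x \in S2 -> 1 <= x <= n by move/(fsubsetP sub2); rewrite in_interval.
have max1 : fmax S1 \in S1 by apply: fmax_in; rewrite c1.
have max2 : fmax S2 \in S2 by apply: fmax_in; rewrite c2; lia.
have col1 x (xS : x \in S1) := extremal_coloringE (m1 _ _ xS max1).
have col2 x (xS : x \in S2) := extremal_coloringE (m2 _ _ xS max2).
have le1 x (xS : x \in S1) := le_fmax xS.
have ge2 x (xS : x \in S2) : fmax S1 < x := leq_trans lt12 (fmin_le xS).
(* Each of the first two colour blocks has only s - 1 elements. *)
have max1_ge : 2 * s - 1 <= fmax S1.
  rewrite leqNgt; apply/negP => lt1.
  have [lt1s|ge1s] := ltnP (fmax S1) s.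
    have := @card_one_interval S1 1 (s - 1); rewrite c1 => h.
    have : s <= (s - 1).+1 - 1 by apply: h => x xS; move: (in1 x xS) (le1 x xS); lia.
    by lia.
  have := @card_one_interval S1 s (2 * s - 2); rewrite c1 => h.
  have : s <= (2 * s - 2).+1 - s.
    by apply: h => x xS; move: (col1 x xS) (le1 x xS); lia.
  by lia.
(* Otherwise [S2] has the colour of the last block and, lying beyond 2s - 1, is contained in it; but
   that block has at most r - 1 elements up to n. *)
have max2_le : fmax S2 <= 4 * s - 3.
  rewrite leqNgt; apply/negP => gt2.
  have := @card_one_interval S2 (4 * s - 2) n; rewrite c2 => h.
  have : r <= n.+1 - (4 * s - 2).
    by apply: h => x xS; move: (col2 x xS) (in2 x xS) (ge2 x xS); lia.
  by lia.
have max12 := ge2 _ max2.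
have diam2 : diam S2 <= 2 * s - 3.
  have -> : 2 * s - 3 = (4 * s - 3) - (2 * s) by lia.
  apply: diam_le => [|x xS]; first by rewrite c2; lia.
  by move: (ge2 x xS) (le_fmax xS); lia.
have [/hasP[x xS lts]|/hasPn nlt] := boolP (has (fun x => x < s) S1).
  have := @diam_split S1 (s - 1) (2 * s - 1) x (fmax S1) xS _ max1 max1_ge.
  rewrite c1 => h; have : s + (2 * s - 1) <= diam S1 + (s - 1) + 2.
    apply: h => [|z zS]; first by lia.
    by move: (col1 z zS) (le1 z zS); lia.
  by lia.
have := @card_one_interval S1 (2 * s - 1) (fmax S1); rewrite c1 => h1.
have {h1} : s <= (fmax S1).+1 - (2 * s - 1).
  apply: h1 => x xS; have /= := nlt _ xS; move: (col1 x xS) (le1 x xS); lia.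
have := @card_one_interval S2 (fmax S1).+1 (4 * s - 3); rewrite c2 => h2.
have : r <= (4 * s - 3).+1 - (fmax S1).+1.
  apply: h2 => x xS; move: (ge2 x xS) (le_fmax xS); lia.
by lia.
Qed.

(** A sum of m values in {0, 1} lies between 0 and m, so m divides it only if all values are 0 or
    all are 1. *)
Lemma zero_sum_monochromatic m (Delta : nat -> 'I_2) (X : {fset nat}) :
  #|` X| = m -> zero_sum m (fun x => Posz (Delta x)) X -> monochromatic Delta X.
Proof.
move=> cX; have lt2 x := ltn_ord (Delta x).
pose k := \sum_(x <- X) (Delta x : nat); pose l := \sum_(x <- X) (1 - Delta x).
have kl : k + l = m.
  rewrite -big_split /= -cX -[RHS]sum1_size; apply: eq_bigr => x _.
  by move: (lt2 x); lia.
rewrite /zero_sum => /eqP; rewrite eqz_mod_dvd subr0.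
have -> : (\sum_(y <- X) Posz (Delta y) = Posz k)%R.
  by rewrite /k (big_morph _ PoszD (erefl (Posz 0))).
rewrite dvdzE /= => mk.
have [k0|l0] : k = 0 \/ l = 0.
  by case/dvdnP: mk => -[|j]; [left | right; nia].
  move/eqP: k0; rewrite sum_nat_seq_eq0 => /allP h x y /h/eqP hx /h/eqP hy.
  by apply: val_inj; rewrite /= hx hy.
move/eqP: l0; rewrite sum_nat_seq_eq0 => /allP h x y /h/eqP hx /h/eqP hy.
by apply: val_inj => /=; move: (lt2 x) (lt2 y) hx hy; lia.
Qed.

(** This carries the lower bound from [f2] to [fZ] and the upper bound from [fZ] to [f2]. *)
Lemma forces_zero_sum_mono2 s r n : forces_zero_sum s r n -> forces_mono2 s r n.
Proof.
move=> fz Delta; have [S1 [S2 [adm z1 z2]]] := fz (fun x => Posz (Delta x)).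
have [_ [c1 c2] _ _] := adm.
by exists S1, S2; split=> //; apply: zero_sum_monochromatic; eassumption.
Qed.

(** * The upper bound *)

Lemma forces_zero_sum_ub s r : 3 <= s -> s <= r -> r <= 2 * s - 2 ->
  s + s %/ gcdn r s - 1 <= r -> forces_zero_sum s r (4 * s + r - 3).
Proof.
move=> s3 sr r2s rgcd Delta; set n := 4 * s + r - 3.
have en : n = 4 * s + r - 3 by [].
(* The threshold 2s - 2 is the diameter of [1, 2s - 1], where EGZ finds [S1]. *)
pose long S2 := [/\ S2 `<=` interval (2 * s) n, #|` S2| = r,
  zero_sum r Delta S2 & 2 * s - 2 <= diam S2].
have [[S2 [sub2 c2 z2 diam2]]|nlong] := boolp.pselect (exists S2, long S2).
  have [||S1 [sub1 c1 z1]] := @egz_fset s Delta (interval 1 (2 * s - 1)).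
  - by lia.
  - by rewrite card_interval; lia.
  have in1 x : x \in S1 -> 1 <= x <= 2 * s - 1.
    by move/(fsubsetP sub1); rewrite in_interval.
  have in2 x : x \in S2 -> 2 * s <= x <= n.
    by move/(fsubsetP sub2); rewrite in_interval.
  exists S1, S2; split=> //; split=> //.
  - split; apply/fsubsetP => x; rewrite in_interval.
      by move/in1; lia.
    by move/in2; lia.
  - apply: (@leq_trans (2 * s)); last by apply: fmin_ge => [|x /in2 /andP[]//]; lia.
    apply: (@leq_ltn_trans (2 * s - 1)); last by lia.
    by apply: fmax_le => x /in1 /andP[].
  - apply: leq_trans diam2; have -> : 2 * s - 2 = 2 * s - 1 - 1 by lia.
    by apply: diam_le => //; rewrite c1; lia.
pose F := interval (2 * s) (2 * s + r - 1); pose G := interval (4 * s - 2) n.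
(* [F'] drops the last element of [F] and [G'] the first of [G], so the unions of [F] with [G'] and
   of [F'] with [G] have 2r - 1 elements each. *)
pose F' := interval (2 * s) (2 * s + r - 2); pose G' := interval (4 * s - 1) n.
have cF : #|` F| = r by rewrite card_interval; lia.
have cG : #|` G| = r by rewrite card_interval; lia.
have cU (X Y : {fset nat}) : (forall x, x \in X -> x \in Y -> False) ->
    #|` X `|` Y| = #|` X| + #|` Y|.
  move=> d; rewrite cardfsU; suff -> : X `&` Y = fset0 by rewrite cardfs0 subn0.
  by apply/fsetP => x; rewrite !inE; apply/andP => -[/d].
have uF B : B `<=` F `|` G' -> #|` B| = r -> zero_sum r Delta B -> B = F.
  move=> sub cB Bz.
  have inB x : x \in B -> (2 * s <= x <= 2 * s + r - 1) || (4 * s - 1 <= x <= n).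
    by move/(fsubsetP sub); rewrite inE !in_interval.
  suff BF : B `<=` F by apply/eqP; rewrite eqEfcard BF cB cF /=.
  apply/fsubsetP => y yB; rewrite in_interval; apply: contraT => yF.
  case: nlong; exists B; split=> //.
    by apply/fsubsetP => x /inB; rewrite in_interval; lia.
  (* If [B] also meets [F], the gap before [G'] forces diameter at least 2s - 2; if not, [B] would
     fit into the r - 1 elements of [G']. *)
  have [/hasP[x xB xF]|/hasPn nF] := boolP (has (fun x => x <= 2 * s + r - 1) B).
    have : #|` B| + (4 * s - 1) <= diam B + (2 * s + r - 1) + 2.
      apply: (diam_split xB xF yB); first by move: (inB y yB); lia.
      by move=> z /inB; lia.
    by rewrite cB; lia.
  have : #|` B| <= n.+1 - (4 * s - 1).
    by apply: card_one_interval => x xB; move: (inB x xB) (nF x xB); lia.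
  by rewrite cB; lia.
have zG : zero_sum r Delta G.
  have [||B [sub cB Bz]] := @egz_fset r Delta (F' `|` G).
  - by lia.
  - by rewrite cU ?card_interval => [|x]; rewrite ?in_interval; lia.
  have inB x : x \in B -> (2 * s <= x <= 2 * s + r - 2) || (4 * s - 2 <= x <= n).
    by move/(fsubsetP sub); rewrite inE !in_interval.
  suff BG : B `<=` G.
    by have /eqP <- : B == G by rewrite eqEfcard BG cB cG /=.
  apply/fsubsetP => y yB; rewrite in_interval; apply: contraT => yG.
  case: nlong; exists B; split=> //.
    by apply/fsubsetP => x /inB; rewrite in_interval; lia.
  have [/hasP[x xB xF]|/hasPn nF] := boolP (has (fun x => 4 * s - 2 <= x) B).
    have : #|` B| + (4 * s - 2) <= diam B + (2 * s + r - 2) + 2.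
      apply: (diam_split yB _ xB xF); first by move: (inB y yB); lia.
      by move=> z /inB; lia.
    by rewrite cB; lia.
  have : #|` B| <= (2 * s + r - 2).+1 - (2 * s).
    by apply: card_one_interval => x xB; move: (inB x xB) (nF x xB); lia.
  by rewrite cB; lia.
have conF : {in F &, forall x y, (r%:Z %| (Delta x - Delta y)%R)%Z}.
  apply: (@egz_unique_fset r Delta (F `|` G')) => //.
  - by lia.
  - by rewrite cU ?card_interval => [|x]; rewrite ?in_interval; lia.
  - exact: fsubsetUl.
pose d := gcdn r s; pose t := s %/ d.
have d0 : 0 < d by rewrite gcdn_gt0; lia.
have es : s = d * t by rewrite mulnC divnK // dvdn_gcdr.
have t0 : 0 < t by rewrite lt0n; apply: contraTneq s3; rewrite {1}es => ->; rewrite muln0.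
(* Since d divides r, [Delta] is constant modulo d on [F], and the size required is s + s/d - 1. *)
have [|x xF|S1 [sub1 c1 z1]] := @egz_congruent_fset d t (Delta (2 * s)) Delta F d0 t0.
- by rewrite -es cF.
- apply: (@dvdz_trans r%:Z); first by rewrite dvdzE /= dvdn_gcdl.
  by apply: conF => //; rewrite in_interval; lia.
rewrite -es in c1 z1.
have in1 x : x \in S1 -> 2 * s <= x <= 2 * s + r - 1.
  by move/(fsubsetP sub1); rewrite in_interval.
have in2 x : x \in G -> 4 * s - 2 <= x <= n by rewrite in_interval.
exists S1, G; split=> //; split=> //.
- split; apply/fsubsetP => x; rewrite ?in_interval.
    by move/in1; lia.
  by lia.
- apply: (@leq_trans (4 * s - 2)); last by apply: fmin_ge => [|x /in2 /andP[]//]; lia.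
  (* By r <= 2s - 2, the end of [F] precedes the start 4s - 2 of [G]. *)
  apply: (@leq_ltn_trans (2 * s + r - 1)); last by lia.
  by apply: fmax_le => x /in1 /andP[].
- apply: (@leq_trans (2 * s + r - 1 - 2 * s)).
    by apply: diam_le => //; rewrite c1; lia.
  have a : 4 * s - 2 \in G by rewrite in_interval; lia.
  have b : n \in G by rewrite in_interval; lia.
  by apply: leq_trans (leq_sub (le_fmax b) (fmin_le a)); lia.
Qed.

Theorem theorem3p6 (s r : nat) (hs : 3 <= s) (hrs : s <= r)
    (hr : r <= 2 * s - 2) (hgcd : 1 < gcdn r s)
    (hbound : s + s %/ gcdn r s - 1 <= r) :
  f2 s r = fZ s r /\ fZ s r = 4 * s + r - 3.
Proof.
have n0 : 0 < 4 * s + r - 3 by lia.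
have ub := forces_zero_sum_ub hs hrs hr hbound.
have lb m : 0 < m -> forces_mono2 s r m -> 4 * s + r - 3 <= m.
  by move=> _; apply: forces_mono2_lb => //; lia.
have -> : fZ s r = 4 * s + r - 3.
  apply/(least_posP _ n0); split=> // m m0 /forces_zero_sum_mono2.
  exact: lb.
split=> //; apply/(least_posP _ n0); split=> //.
exact: forces_zero_sum_mono2.
Qed.
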